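(* Let $H$ be a Hopf algebra over a field $k$. Every partial $H$-module category $\mathcal{C}$ has a minimal globalization, which is unique up to isomorphism.
   Context: Sweedler notation $\Delta(h)=\sum h_{(1)}\otimes h_{(2)}$ is used. For a $k$-linear (semi)category $\mathcal{C}$, $\mathcal{C}_0$ is its collection of objects, ${}_y\mathcal{C}_x=\operatorname{Hom}_{\mathcal{C}}(x,y)$, and ${}_x1_x$ is the identity of $x$ when it exists. A partial $H$-module category is a $k$-linear category $\mathcal{C}$ with $k$-linear maps $H\otimes{}_y\mathcal{C}_x\to{}_y\mathcal{C}_x$, $h\otimes f\mapsto h\cdot f$, such that for all $x,y,z\in\mathcal{C}_0$, $h,l\in H$, $f\in{}_y\mathcal{C}_x$, $f'\in{}_z\mathcal{C}_y$: (1) $1_H\cdot f=f$; (2) $h\cdot(f'\circ f)=\sum(h_{(1)}\cdot f')\circ(h_{(2)}\cdot f)$; (3) $h\cdot(l\cdot f)=\sum(h_{(1)}\cdot{}_y1_y)\circ((h_{(2)}l)\cdot f)=\sum((h_{(1)}l)\cdot f)\circ(h_{(2)}\cdot{}_x1_x)$. A $k$-semicategory is defined like a $k$-linear category but without requiring identity morphisms (composition is $k$-bilinear and associative). A $k$-semifunctor is a $k$-linear assignment on objects and morphisms preserving composition (not necessarily identities). A semicategory over a set $X$ has object set $X$; an $X$-semifunctor between semicategories over $X$ is a semifunctor that is the identity on objects. An ideal of a $k$-semicategory $\mathcal{B}$ is a family of subspaces ${}_y\mathcal{I}_x\subseteq{}_y\mathcal{B}_x$ closed under composition on either side with arbitrary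 morphisms of $\mathcal{B}$. A central idempotent of $\mathcal{B}$ is a family $e=\{{}_xe_x\}$ of idempotents ${}_xe_x\in{}_x\mathcal{B}_x$ with ${}_ye_y\circ f={}f\circ{}_xe_x$ for all $f\in{}_y\mathcal{B}_x$; the ideal it generates is ${}_y\mathcal{I}_x={}_ye_y\,{}_y\mathcal{B}_x={}_y\mathcal{B}_x\,{}_xe_x$. An $H$-module semicategory is a $k$-semicategory $\mathcal{B}$ each of whose morphism spaces is an $H$-module, with action $\rhd$, such that $h\rhd(f'\circ f)=\sum(h_{(1)}\rhd f')\circ(h_{(2)}\rhd f)$ for all composable $f',f$ and $h\in H$. A globalization of a partial $H$-module category $\mathcal{C}$ is a pair $(\mathcal{B},F)$ where (a) $\mathcal{B}$ is an $H$-module semicategory over $\mathcal{C}_0$, with action $\rhd$; (b) $F:\mathcal{C}\to\mathcal{B}$ is a faithful $\mathcal{C}_0$-semifunctor and $F(\mathcal{C})$ is an ideal of $\mathcal{B}$, generated by the central idempotent $e=\{F({}_x1_x)\}_{x\in\mathcal{C}_0}$; (c) $\mathcal{B}=H\rhd F(\mathcal{C})$, i.e. each ${}_y\mathcal{B}_x$ is the $k$-span of $\{h\rhd F(f): h\in H, f\in{}_y\mathcal{C}_x\}$; (d) for every $f\in{}_y\mathcal{C}_x$ and $h\in H$, $F(h\cdot f)=F({}_y1_y)(h\rhd F(f))=(h\rhd F(f))F({}_x1_x)$. It is minimal if in addition (e) for all $x,y\in\mathcal{C}_0$, $h_1,\dots,h_n\in H$, $f^1,\dots,f^n\in{}_y\mathcal{C}_x$: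 if $\sum_i (lh_i)\cdot f^i=0$ for all $l\in H$, then $\sum_i h_i\rhd F(f^i)=0$. An isomorphism between globalizations $(\mathcal{A},F)$ and $(\mathcal{B},G)$ of $\mathcal{C}$ is a $\mathcal{C}_0$-semifunctor $\Phi:\mathcal{A}\to\mathcal{B}$ that is bijective on all morphism spaces, commutes with the $H$-actions, and satisfies $\Phi\circ F=G$. *)

(* Defs.v *)
From HB Require Import structures.
From mathcomp Require Import all_boot all_algebra.
From mathcomp Require Import boolp classical_sets.

Set Implicit Arguments.
Unset Strict Implicit.
Unset Printing Implicit Defensive.

Import GRing.Theory.
Local Open Scope quotient_scope.
Local Open Scope classical_set_scope.
Local Open Scope ring_scope.

Reserved Notation "u ⊗ v" (at level 40, left associativity).
Reserved Notation "\sweedler_ ( u , v <- t ) E"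
  (at level 41, E at level 41, u name, v name, t at level 200,
   format "'[' \sweedler_ ( u ,  v  <-  t ) '/  '  E ']'").
Reserved Notation "1_[ x ]" (format "1_[ x ]").

(* The tensor product U ⊗ V over k: finite formal sums of pairs, modulo the   *)
(* least additive congruence that makes the pairing bilinear.                 *)
Section TensorProduct.
Variables (k : fieldType) (U V : lmodType k).
Implicit Types (s t : seq (U * V)) (u : U) (v : V) (a : k).

Inductive tensor_eq : seq (U * V) -> seq (U * V) -> Prop :=
| teq_refl s : tensor_eq s s
| teq_sym s t : tensor_eq s t -> tensor_eq t s
| teq_trans s t r : tensor_eq s t -> tensor_eq t r -> tensor_eq s r
| teq_cat s s' t t' :
    tensor_eq s s' -> tensor_eq t t' -> tensor_eq (s ++ t) (s' ++ t')
| teq_catC s t : tensor_eq (s ++ t) (t ++ s)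
| teq_zero v : tensor_eq [:: (0, v)] [::]
| teq_addl u u' v : tensor_eq [:: (u + u', v)] [:: (u, v); (u', v)]
| teq_addr u v v' : tensor_eq [:: (u, v + v')] [:: (u, v); (u, v')]
| teq_scale a u v : tensor_eq [:: (a *: u, v)] [:: (u, a *: v)].

Definition tensor_eqb s t : bool := `[< tensor_eq s t >].

Lemma tensor_eqb_refl : reflexive tensor_eqb.
Proof. by move=> s; apply/asboolP/teq_refl. Qed.

Lemma tensor_eqb_sym : symmetric tensor_eqb.
Proof. by move=> s t; apply/asboolP/asboolP; apply: teq_sym. Qed.

Lemma tensor_eqb_trans : transitive tensor_eqb.
Proof.
by move=> t s r /asboolP st /asboolP tr; apply/asboolP; apply: teq_trans tr.
Qed.

Canonical tensor_equiv :=
  EquivRel tensor_eqb tensor_eqb_refl tensor_eqb_sym tensor_eqb_trans.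

Definition tensor := {eq_quot tensor_equiv}.

HB.instance Definition _ := Choice.on tensor.
HB.instance Definition _ := EqQuotient.on tensor.

Lemma tensorP s t : tensor_eq s t <-> \pi_tensor s = \pi_tensor t.
Proof.
split=> [st|/eqmodP/asboolP//].
by apply/eqmodP/asboolP.
Qed.

Definition tens u v : tensor := \pi_tensor [:: (u, v)].

Definition tscale_seq a s := [seq (a *: p.1, p.2) | p <- s].

Lemma teq_scale_seq a s t :
  tensor_eq s t -> tensor_eq (tscale_seq a s) (tscale_seq a t).
Proof.
rewrite /tscale_seq.
elim=> {s t} /= [s|s t _|s t r _ + _|s s' t t' _ + _|s t|v|u u' v|u v v'|b u v].
- exact: teq_refl.
- exact: teq_sym.
- exact: teq_trans.
- by rewrite !map_cat; apply: teq_cat.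
- by rewrite !map_cat; apply: teq_catC.
- by rewrite scaler0; apply: teq_zero.
- by rewrite scalerDr; apply: teq_addl.
- exact: teq_addr.
- by rewrite scalerA mulrC -scalerA; apply: teq_scale.
Qed.

Definition tadd (x y : tensor) : tensor := \pi_tensor (repr x ++ repr y).
Definition tscale a (x : tensor) : tensor := \pi_tensor (tscale_seq a (repr x)).
Definition topp (x : tensor) : tensor := tscale (-1) x.
Definition tzero : tensor := \pi_tensor [::].

Lemma repr_teq s : tensor_eq (repr (\pi_tensor s)) s.
Proof. by apply/tensorP; rewrite reprK. Qed.

Lemma taddE s t : tadd (\pi_tensor s) (\pi_tensor t) = \pi_tensor (s ++ t).
Proof. by apply/tensorP/teq_cat; apply: repr_teq. Qed.

Lemma tscaleE a s : tscale a (\pi_tensor s) = \pi_tensor (tscale_seq a s).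
Proof. by apply/tensorP/teq_scale_seq/repr_teq. Qed.

Lemma tensorW (P : tensor -> Prop) : (forall s, P (\pi_tensor s)) -> forall x, P x.
Proof. by move=> Ps x; rewrite -[x]reprK; apply: Ps. Qed.

Lemma taddA : associative tadd.
Proof.
elim/tensorW=> s; elim/tensorW=> t; elim/tensorW=> r.
by rewrite !taddE catA.
Qed.

Lemma taddC : commutative tadd.
Proof.
elim/tensorW=> s; elim/tensorW=> t; rewrite !taddE.
exact/tensorP/teq_catC.
Qed.

Lemma tadd0 : left_id tzero tadd.
Proof. by elim/tensorW=> s; rewrite taddE. Qed.

Lemma tscaleDl x : {morph tscale^~ x : a b / a + b >-> tadd a b}.
Proof.
move=> a b; elim/tensorW: x => s; rewrite !tscaleE taddE; apply/tensorP.
elim: s => [|[u v] s IHs]; first exact: teq_refl.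
have := teq_cat (teq_addl (a *: u) (b *: u) v) IHs.
rewrite -scalerDl => /teq_trans; apply => /=.
apply: (@teq_cat [:: _] [:: _] (_ :: _)); first exact: teq_refl.
rewrite -[X in tensor_eq X _]cat1s -[X in tensor_eq _ (_ ++ X)]cat1s !catA.
by apply: teq_cat; [apply: teq_catC | apply: teq_refl].
Qed.

Lemma tscale0 x : tscale 0 x = tzero.
Proof.
elim/tensorW: x => s; rewrite tscaleE; apply/tensorP.
elim: s => [|[u v] s IHs]; first exact: teq_refl.
apply: (teq_trans (t := [::] ++ [::])); last exact: teq_refl.
by rewrite /= scale0r; apply: (teq_cat (teq_zero v) IHs).
Qed.

Lemma tscale1 : left_id 1 tscale.
Proof.
elim/tensorW=> s; rewrite tscaleE; congr \pi.
by rewrite -[RHS]map_id; apply: eq_map => -[u v] /=; rewrite scale1r.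
Qed.

Lemma taddN : left_inverse tzero topp tadd.
Proof. by move=> x; rewrite -{2}[x]tscale1 -tscaleDl addNr tscale0. Qed.

HB.instance Definition _ := GRing.isZmodule.Build tensor taddA taddC tadd0 taddN.

Lemma tensorD s t : \pi_tensor s + \pi_tensor t = \pi_tensor (s ++ t).
Proof. exact: taddE. Qed.

Lemma tscaleA a b x : tscale a (tscale b x) = tscale (a * b) x.
Proof.
elim/tensorW: x => s; rewrite !tscaleE /tscale_seq -map_comp; congr \pi.
by apply: eq_map => -[u v] /=; rewrite scalerA.
Qed.

Lemma tscaleDr : right_distributive tscale +%R.
Proof.
move=> a; elim/tensorW=> s; elim/tensorW=> t.
by rewrite tensorD !tscaleE tensorD /tscale_seq map_cat.
Qed.

HB.instance Definition _ :=
  GRing.Zmodule_isLmodule.Build k tensor tscaleA tscale1 tscaleDr tscaleDl.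

Lemma tensorZ a s : a *: \pi_tensor s = \pi_tensor (tscale_seq a s).
Proof. exact: tscaleE. Qed.

Lemma tens_bilinear : bilinear_for *:%R *:%R tens.
Proof.
have tensD u u' v v' : \pi_tensor [:: (u, v); (u', v')] = tens u v + tens u' v'.
  by rewrite tensorD.
have tensZ a u v : tens (a *: u) v = a *: tens u v by rewrite tensorZ.
split=> [v a u u'|u a v v'] /=.
  by rewrite -tensZ -tensD; apply/tensorP/teq_addl.
have -> : a *: tens u v = tens u (a *: v).
  by rewrite -tensZ; apply/tensorP/teq_scale.
by rewrite -tensD; apply/tensorP/teq_addr.
Qed.

HB.instance Definition _ := bilinear_isBilinear.Build k U V tensor
  *:%R *:%R tens tens_bilinear.

Lemma tensor_pi s : \pi_tensor s = \sum_(p <- s) tens p.1 p.2.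
Proof.
elim: s => [|[u v] s IHs]; first by rewrite big_nil.
by rewrite big_cons -IHs tensorD.
Qed.

(* Sweedler summation over a representative of t; for bilinear b the value   *)
(* does not depend on the representative (tlift_tens, tlift_is_linear).      *)
Definition tlift (W : lmodType k) (b : U -> V -> W) (t : tensor) : W :=
  \sum_(p <- repr t) b p.1 p.2.

Section Lift.
Variables (W : lmodType k) (b : U -> V -> W).
Hypothesis b_bilin : bilinear_for *:%R *:%R b.

Lemma tensor_eq_sum s t : tensor_eq s t ->
  \sum_(p <- s) b p.1 p.2 = \sum_(p <- t) b p.1 p.2.
Proof.
have [bl br] := b_bilin.
have bDl u u' v : b (u + u') v = b u v + b u' v.
  by have := bl v 1 u u'; rewrite /= !scale1r.
have bDr u v v' : b u (v + v') = b u v + b u v'.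
  by have := br u 1 v v'; rewrite /= !scale1r.
have b0l v : b 0 v = 0.
  by apply: (addrI (b 0 v)); rewrite -bDl !addr0.
have b0r u : b u 0 = 0.
  by apply: (addrI (b u 0)); rewrite -bDr !addr0.
have bZl a u v : b (a *: u) v = a *: b u v.
  by have := bl v a u 0; rewrite /= b0l !addr0.
have bZr a u v : b u (a *: v) = a *: b u v.
  by have := br u a v 0; rewrite /= b0r !addr0.
elim=> {s t} /= [//|//|s t r _ -> _ //|s s' t t' _ ss' _ tt'|s t|v|u u' v|u v v'|a u v];
  rewrite ?big_cat ?big_cons ?big_nil /= ?addr0 //.
- by rewrite ss' tt'.
- by rewrite addrC.
- by rewrite bZl bZr.
Qed.

Lemma tlift_pi s : tlift b (\pi_tensor s) = \sum_(p <- s) b p.1 p.2.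
Proof. exact/tensor_eq_sum/repr_teq. Qed.

Lemma tlift_tens u v : tlift b (tens u v) = b u v.
Proof. by rewrite tlift_pi big_seq1. Qed.

Lemma tlift_is_linear : linear (tlift b).
Proof.
move=> a; elim/tensorW=> s; elim/tensorW=> t.
rewrite tensorZ tensorD !tlift_pi big_cat; congr (_ + _).
rewrite big_map scaler_sumr; apply: eq_bigr => -[u v] _ /=.
have [bl _] := b_bilin.
have b0 : b 0 v = 0.
  have := bl v 1 0 0; rewrite /= scaler0 addr0 scale1r -[LHS]addr0.
  by move/addrI.
by have := bl v a u 0; rewrite /= b0 !addr0.
Qed.

End Lift.

End TensorProduct.

Notation "u ⊗ v" := (tens u v) : ring_scope.
Notation "\sweedler_ ( u , v <- t ) E" := (tlift (fun u v => E) t) : ring_scope.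

HB.mixin Record Algebra_isBialgebra (k : fieldType) H & GRing.Algebra k H := {
  comul : {linear H -> tensor H H};
  counit : {scalar H};
  comulA : forall h : H,
    \sweedler_(h1, h2 <- comul h) \sweedler_(h11, h12 <- comul h1)
      (h11 ⊗ (h12 ⊗ h2))
    = \sweedler_(h1, h2 <- comul h) (h1 ⊗ comul h2);
  counitl : forall h : H, \sweedler_(h1, h2 <- comul h) (counit h1 *: h2) = h;
  counitr : forall h : H, \sweedler_(h1, h2 <- comul h) (counit h2 *: h1) = h;
  comul1 : comul 1 = 1 ⊗ 1;
  comulM : forall g h : H, comul (g * h) =
    \sweedler_(g1, g2 <- comul g) \sweedler_(h1, h2 <- comul h)
      ((g1 * h1) ⊗ (g2 * h2));
  counit1 : counit 1 = 1;
  counitM : forall g h : H, counit (g * h) = counit g * counit h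
}.

#[short(type="bialgType")]
HB.structure Definition Bialgebra (k : fieldType) :=
  { H of Algebra_isBialgebra k H & GRing.Algebra k H }.

HB.mixin Record Bialgebra_isHopf (k : fieldType) H & Bialgebra k H := {
  antipode : {linear H -> H};
  antipodel : forall h : H,
    \sweedler_(h1, h2 <- comul h) (antipode h1 * h2) = (counit h)%:A;
  antipoder : forall h : H,
    \sweedler_(h1, h2 <- comul h) (h1 * antipode h2) = (counit h)%:A
}.

#[short(type="hopfAlgType")]
HB.structure Definition HopfAlgebra (k : fieldType) :=
  { H of Bialgebra_isHopf k H & Bialgebra k H }.

(* hom x y is the space of morphisms from x to y, written ${}_y B_x$; comp is *)
(* in the usual order, comp g f = g ∘ f.                                      *)
Record semicategory (k : fieldType) (X : Type) := Semicategory {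
  hom :> X -> X -> lmodType k;
  comp : forall x y z, {bilinear hom y z -> hom x y -> hom x z};
  compA : forall x y z w (h : hom z w) (g : hom y z) (f : hom x y),
    comp x z w h (comp x y z g f) = comp x y w (comp y z w h g) f
}.

Arguments comp {k X s x y z}.
Notation "g \o_ f" := (comp g f) (at level 40, left associativity) : ring_scope.

Record linear_category (k : fieldType) := LinearCategory {
  obj : Type;
  semicat_of :> semicategory k obj;
  idm : forall x, semicat_of x x;
  comp1m : forall x y (f : semicat_of x y), idm y \o_ f = f;
  compm1 : forall x y (f : semicat_of x y), f \o_ idm x = f
}.

Arguments idm {k l} x.
Notation "1_[ x ]" := (idm x) : ring_scope.

Record partial_module_category (k : fieldType) (H : hopfAlgType k) :=
  PartialModuleCategory {
  lincat_of :> linear_category k;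
  pact : forall x y, {bilinear H -> lincat_of x y -> lincat_of x y};
  pact1 : forall x y (f : lincat_of x y), pact x y 1 f = f;
  pact_comp : forall x y z (h : H) (g : lincat_of y z) (f : lincat_of x y),
    pact x z h (g \o_ f) =
    \sweedler_(h1, h2 <- comul h) (pact y z h1 g \o_ pact x y h2 f);
  pact_actl : forall x y (h l : H) (f : lincat_of x y),
    pact x y h (pact x y l f) =
    \sweedler_(h1, h2 <- comul h) (pact y y h1 1_[y] \o_ pact x y (h2 * l) f);
  pact_actr : forall x y (h l : H) (f : lincat_of x y),
    pact x y h (pact x y l f) =
    \sweedler_(h1, h2 <- comul h) (pact x y (h1 * l) f \o_ pact x x h2 1_[x])
}.

Arguments pact {k H p x y}.

Record module_semicategory (k : fieldType) (H : hopfAlgType k) (X : Type) :=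
  ModuleSemicategory {
  msemicat_of :> semicategory k X;
  act : forall x y, {bilinear H -> msemicat_of x y -> msemicat_of x y};
  act1 : forall x y (f : msemicat_of x y), act x y 1 f = f;
  actM : forall x y (h l : H) (f : msemicat_of x y),
    act x y (h * l) f = act x y h (act x y l f);
  act_comp : forall x y z (h : H) (g : msemicat_of y z) (f : msemicat_of x y),
    act x z h (g \o_ f) =
    \sweedler_(h1, h2 <- comul h) (act y z h1 g \o_ act x y h2 f)
}.

Arguments act {k H X m x y}.

(* Semifunctors over X are the identity on objects. *)
Record semifunctor (k : fieldType) (X : Type) (A B : semicategory k X) :=
  Semifunctor {
  fmap : forall x y, {linear A x y -> B x y};
  fmap_comp : forall x y z (g : A y z) (f : A x y),
    fmap x z (g \o_ f) = fmap y z g \o_ fmap x y f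
}.

Arguments fmap {k X A B} s {x y}.

Definition faithful (k : fieldType) (X : Type) (A B : semicategory k X)
    (F : semifunctor A B) :=
  forall x y, injective (@fmap _ _ _ _ F x y).

Section Ideals.
Variables (k : fieldType) (X : Type) (B : semicategory k X).

Record is_ideal (I : forall x y, set (B x y)) : Prop := IsIdeal {
  ideal0 : forall x y, I x y 0;
  idealP : forall x y (a : k) (f g : B x y), I x y f -> I x y g ->
    I x y (a *: f + g);
  ideal_compl : forall x y z (g : B y z) (f : B x y),
    I x y f -> I x z (g \o_ f);
  ideal_compr : forall x y z (g : B y z) (f : B x y),
    I y z g -> I x z (g \o_ f)
}.

Record central_idempotent (e : forall x, B x x) : Prop := CentralIdempotent {
  cidem_idem : forall x, e x \o_ e x = e x;
  cidem_central : forall x y (f : B x y), e y \o_ f = f \o_ e x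
}.

Definition generated_by (I : forall x y, set (B x y)) (e : forall x, B x x) :=
  forall x y, I x y = range (fun f : B x y => e y \o_ f) /\
              I x y = range (fun f : B x y => f \o_ e x).

End Ideals.

Definition image_of (k : fieldType) (X : Type) (A B : semicategory k X)
  (F : semifunctor A B) : forall x y, set (B x y) :=
  fun x y => range (@fmap _ _ _ _ F x y).

Section Globalization.
Variables (k : fieldType) (H : hopfAlgType k) (C : partial_module_category H).

Record globalization := Globalization {
  gsemicat :> module_semicategory H (obj C);
  gmap : semifunctor C gsemicat;
  gmap_faithful : faithful gmap;
  gmap_ideal : is_ideal (image_of gmap);
  gmap_idem : central_idempotent (fun x => fmap gmap 1_[x]);
  gmap_gen : generated_by (image_of gmap) (fun x => fmap gmap 1_[x]);
  gmap_span : forall x y (g : gsemicat x y),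
    exists (n : nat) (a : 'I_n -> k) (h : 'I_n -> H) (f : 'I_n -> C x y),
      g = \sum_i a i *: act (h i) (fmap gmap (f i));
  gmap_actl : forall x y (h : H) (f : C x y),
    fmap gmap (pact h f) = fmap gmap 1_[y] \o_ act h (fmap gmap f);
  gmap_actr : forall x y (h : H) (f : C x y),
    fmap gmap (pact h f) = act h (fmap gmap f) \o_ fmap gmap 1_[x]
}.

Definition minimal (B : globalization) : Prop :=
  forall (x y : obj C) (n : nat) (h : 'I_n -> H) (f : 'I_n -> C x y),
    (forall l : H, \sum_i pact (l * h i) (f i) = 0) ->
    \sum_i act (h i) (fmap (gmap B) (f i)) = 0.

Record globalization_iso (A B : globalization) := GlobalizationIso {
  iso_map : semifunctor A B;
  iso_bij : forall x y, bijective (@fmap _ _ _ _ iso_map x y);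
  iso_act : forall x y (h : H) (f : A x y),
    fmap iso_map (act h f) = act h (fmap iso_map f);
  iso_gmap : forall x y (f : C x y),
    fmap iso_map (fmap (gmap A) f) = fmap (gmap B) f
}.

End Globalization.

(* Main.v *)
Require Import Defs.
From mathcomp Require Import all_boot all_algebra.
From HB Require Import structures.
From mathcomp Require Import boolp classical_sets functions.

Set Implicit Arguments.
Unset Strict Implicit.
Unset Printing Implicit Defensive.

Import GRing.Theory.
Local Open Scope ring_scope.

(** Below, l . f is the partial action of l on a morphism f of C, and l |> a the
    action of l on a morphism a of a globalization.

    Existence.  In a globalization, cutting l |> a down to the ideal C, for
    every l in H, turns a into a function from H to C x y; in particular f in
    C x y becomes its orbit l |-> l . f.  Take these functions themselves as
    morphisms: Hom(H, C x y) carries the convolution product and the action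
    (h |> g)(l) = g (l h), and the span of the translates of orbits is the
    wanted semicategory.
      - Closure under convolution ([orbit_span_conv]) is where the antipode
        enters: h |> f and t |> g multiply to the sum of the translates by h_1
        of the orbits of f (S(h_2) t . g); see [sweedler_pact_comp].
      - C is an ideal of it because multiplying a function by the orbit of f
        on one side gives the orbit of f composed with the value of that
        function at 1 ([conv_orbit_mapl], [conv_orbit_mapr]).
      - Evaluation at 1 recovers f from its orbit, hence faithfulness, and
        minimality says that a function vanishing everywhere is zero.

    Uniqueness.  In any globalization A the map [orbit_of], sending a to
    l |-> the part of l |> a in C, is a morphism of module semicategories from
    A onto the standard one and maps a morphism of C to its orbit.  Minimality
    of A says that its kernel is zero ([orbit_of_inj]).  Two minimal
    globalizations therefore embed in Hom(H, C x y) with the same image, and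
    the isomorphism [transfer] matches the morphisms with equal image; that it
    respects the whole structure is read off after embedding. *)

(** * Sweedler sums *)

Section Sweedler.
Variables (k : fieldType) (U V U' V' W W' : lmodType k).

Lemma eq_tlift (b b' : U -> V -> W) t :
  (forall u v, b u v = b' u v) -> tlift b t = tlift b' t.
Proof. by move=> bb'; apply: eq_bigr => p _. Qed.

Lemma linear_tlift (phi : W -> W') (b : U -> V -> W) t :
  linear phi -> phi (tlift b t) = \sweedler_(u, v <- t) phi (b u v).
Proof.
move=> phi_lin; pose L := GRing.isLinear.Build k W W' *:%R phi phi_lin.
pose phiL : {linear W -> W'} := HB.pack phi L.
exact: (linear_sum phiL).
Qed.

Lemma tliftP a (b b' : U -> V -> W) t :
  \sweedler_(u, v <- t) (a *: b u v + b' u v) = a *: tlift b t + tlift b' t.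
Proof. by rewrite /tlift scaler_sumr -big_split. Qed.

Lemma exchange_tlift (b : U -> V -> U' -> V' -> W) s t :
  \sweedler_(u, v <- s) \sweedler_(u', v' <- t) b u v u' v' =
  \sweedler_(u', v' <- t) \sweedler_(u, v <- s) b u v u' v'.
Proof. exact: exchange_big. Qed.

Lemma tlift_fct (T : Type) (b : U -> V -> T -> W) t l :
  tlift b t l = \sweedler_(u, v <- t) b u v l.
Proof. by rewrite /tlift fct_sumE. Qed.

End Sweedler.

Section SweedlerComul.
Variables (k : fieldType) (H : hopfAlgType k) (W : lmodType k).

(** Coassociativity as it is used: evaluate the trilinear T on both sides of
    the identity in the triple tensor product. *)
Lemma comul_coassoc (T : H -> H -> H -> W) (h : H) :
    (forall v w, linear (fun u => T u v w)) ->
    (forall u w, linear (fun v => T u v w)) ->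
    (forall u v, linear (fun w => T u v w)) ->
  \sweedler_(h1, h2 <- comul h) \sweedler_(h11, h12 <- comul h1) T h11 h12 h2 =
  \sweedler_(h1, h2 <- comul h) \sweedler_(h21, h22 <- comul h2) T h1 h21 h22.
Proof.
move=> Tl Tm Tr.
have Tu u : bilinear_for *:%R *:%R (T u).
  by split=> [w|v] a p q /=; [apply: Tm | apply: Tr].
have Tt : bilinear_for *:%R *:%R (fun u => tlift (T u)).
  split=> [t|u] a p q /=; last exact: tlift_is_linear.
  by rewrite -tliftP; apply: eq_tlift => v w; apply: Tl.
have := congr1 (tlift (fun u => tlift (T u))) (comulA h).
rewrite !(linear_tlift _ _ (tlift_is_linear Tt)) => TE.
transitivity (tlift (fun u => tlift (T u))
  (\sweedler_(h1, h2 <- comul h) (h1 ⊗ comul h2))).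
  rewrite linear_tlift ?TE; last exact: tlift_is_linear.
  rewrite -TE; apply: eq_tlift => u v.
  rewrite (linear_tlift _ _ (tlift_is_linear Tt)); apply: eq_tlift => u' v'.
  by rewrite !tlift_tens.
rewrite (linear_tlift _ _ (tlift_is_linear Tt)); apply: eq_tlift => u v.
by rewrite tlift_tens.
Qed.

Lemma tlift_comulM (b : H -> H -> W) (g h : H) : bilinear_for *:%R *:%R b ->
  tlift b (comul (g * h)) =
  \sweedler_(g1, g2 <- comul g) \sweedler_(h1, h2 <- comul h)
    b (g1 * h1) (g2 * h2).
Proof.
move=> bb; rewrite comulM (linear_tlift _ _ (tlift_is_linear bb)).
apply: eq_tlift => u v; rewrite (linear_tlift _ _ (tlift_is_linear bb)).
by apply: eq_tlift => u' v'; rewrite tlift_tens.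
Qed.

(** h_1 (x) h_2 S(h_3) = h (x) 1, read through a bilinear b. *)
Lemma comul_antipode (b : H -> H -> W) (h : H) : bilinear_for *:%R *:%R b ->
  \sweedler_(h1, h2 <- comul h) \sweedler_(h11, h12 <- comul h1)
    b h11 (h12 * antipode h2) = b h 1.
Proof.
move=> [bl br].
have brl u : linear (b u) by move=> a p q; apply: (br u).
have bll u : linear (b^~ u) by move=> a p q; apply: (bl u).
rewrite (comul_coassoc (T := fun u v w => b u (v * antipode w))).
- rewrite -[in RHS](counitr h) (linear_tlift _ _ (bll 1)).
  apply: eq_tlift => u v; rewrite -(linear_tlift _ _ (brl u)) antipoder.
  rewrite (scalable_linear (brl u)).
  exact/esym/(scalable_linear (bll 1)).
- by move=> v w; apply: bll.
- by move=> u w a p q; rewrite mulrDl -scalerAl brl.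
- by move=> u v a p q; rewrite linearP mulrDr -scalerAr brl.
Qed.

End SweedlerComul.

Section SweedlerComp.
Variables (k : fieldType) (X : Type) (B : semicategory k X) (U V : lmodType k).

Lemma comp_tliftr (x y z : X) (g : B y z) (f : U -> V -> B x y) t :
  g \o_ tlift f t = \sweedler_(u, v <- t) (g \o_ f u v).
Proof.
by apply: (linear_tlift (phi := fun f => g \o_ f)) => a p q; apply: linearPr.
Qed.

Lemma comp_tliftl (x y z : X) (g : U -> V -> B y z) (f : B x y) t :
  tlift g t \o_ f = \sweedler_(u, v <- t) (g u v \o_ f).
Proof.
by apply: (linear_tlift (phi := fun g => g \o_ f)) => a p q; apply: linearPl.
Qed.

End SweedlerComp.

(** * Partial actions on composites *)

Section PartialAction.
Variables (k : fieldType) (H : hopfAlgType k) (C : partial_module_category H).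

(** The factor h_(2) . 1_y produced by the partial associativity law is absorbed
    by h_(1) . g, because g = g 1_y. *)
Lemma pact_comp_pact (x y z : obj C) (h l : H) (g : C y z) (f : C x y) :
  pact h (g \o_ pact l f) =
  \sweedler_(h1, h2 <- comul h) (pact h1 g \o_ pact (h2 * l) f).
Proof.
rewrite pact_comp.
under eq_tlift => u v do rewrite pact_actl comp_tliftr.
rewrite -(comul_coassoc
  (T := fun u v w => pact u g \o_ (pact v 1_[y] \o_ pact (w * l) f))).
- apply: eq_tlift => u v.
  under eq_tlift => u' v' do rewrite Defs.compA.
  by rewrite -comp_tliftl -pact_comp compm1.
- by move=> v w a p q; rewrite !linearPl.
- by move=> v w a p q; rewrite linearPl /= linearPl linearPr.
- by move=> v w a p q; rewrite mulrDl -scalerAl linearPl !linearPr.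
Qed.

Lemma pact_pact_comp (x y z : obj C) (h l : H) (g : C y z) (f : C x y) :
  pact h (pact l g \o_ f) =
  \sweedler_(h1, h2 <- comul h) (pact (h1 * l) g \o_ pact h2 f).
Proof.
rewrite pact_comp.
under eq_tlift => u v do rewrite pact_actr comp_tliftl.
rewrite (comul_coassoc
  (T := fun u v w => (pact (u * l) g \o_ pact v 1_[y]) \o_ pact w f)).
- apply: eq_tlift => u v.
  under eq_tlift => u' v' do rewrite -Defs.compA.
  by rewrite -comp_tliftr -pact_comp comp1m.
- by move=> v w a p q; rewrite mulrDl -scalerAl !linearPl.
- by move=> v w a p q; rewrite linearPl linearPr linearPl.
- by move=> v w a p q; rewrite linearPl linearPr.
Qed.

(** The product of two translated orbits is a combination of translated orbits.
    Expanding the right-hand side yields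
    (l_1 h_1 . g) (l_2 h_2 S(h_3) t . f), and h_2 S(h_3) cancels. *)
Lemma sweedler_pact_comp (x y z : obj C) (l h t : H) (g : C y z) (f : C x y) :
  \sweedler_(l1, l2 <- comul l) (pact (l1 * h) g \o_ pact (l2 * t) f) =
  \sweedler_(h1, h2 <- comul h)
    pact (l * h1) (g \o_ pact (antipode h2 * t) f).
Proof.
under [RHS]eq_tlift => u v.
  rewrite pact_comp_pact tlift_comulM; last first.
    split=> [w|w] a p q; first by rewrite !linearPl.
    by rewrite mulrDl -scalerAl linearPl linearPr.
  over.
symmetry; rewrite [LHS]exchange_tlift; apply: eq_tlift => u v.
under eq_tlift => h1 h2 do under eq_tlift => u' v' do rewrite mulrA -(mulrA v).
rewrite (comul_antipode
  (b := fun p q => pact (u * p) g \o_ pact (v * q * t) f)).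
  by rewrite mulr1.
split=> [q|p] c p1 p2; first by rewrite mulrDr -scalerAr !linearPl.
by rewrite mulrDr mulrDl -scalerAr -scalerAl linearPl linearPr.
Qed.

End PartialAction.

(** * Convolution and translation of functions on H *)

Section Convolution.
Variables (k : fieldType) (H : hopfAlgType k) (X : Type) (B : semicategory k X).

Definition conv (x y z : X) (g : H -> B y z) (f : H -> B x y) : H -> B x z :=
  fun l => \sweedler_(l1, l2 <- comul l) (g l1 \o_ f l2).

Definition translate (x y : X) (h : H) (g : H -> B x y) : H -> B x y :=
  fun l => g (l * h).

Lemma conv_is_bilinear (x y z : X) : bilinear_for *:%R *:%R (@conv x y z).
Proof.
split=> [f a g g'|g a f f']; apply/funext => l; rewrite /conv -[RHS]tliftP.
  by apply: eq_tlift => u v; rewrite linearPl.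
by apply: eq_tlift => u v; rewrite linearPr.
Qed.

HB.instance Definition _ (x y z : X) :=
  bilinear_isBilinear.Build k (H -> B y z) (H -> B x y) (H -> B x z)
    *:%R *:%R (@conv x y z) (@conv_is_bilinear x y z).

Lemma comp_fun_bilinear (x y z : X) (g : H -> B y z) (f : H -> B x y) :
  linear g -> linear f -> bilinear_for *:%R *:%R (fun u v => g u \o_ f v).
Proof.
move=> gL fL; split=> [w|w] a u v; first by rewrite gL linearPl.
by rewrite fL linearPr.
Qed.

Lemma convA (x y z w : X) (p : H -> B z w) (g : H -> B y z) (f : H -> B x y) :
  linear p -> linear g -> linear f -> conv p (conv g f) = conv (conv p g) f.
Proof.
move=> pL gL fL; apply/funext => l; rewrite /conv.
under eq_tlift => u v do rewrite comp_tliftr.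
rewrite -(comul_coassoc (T := fun u v w => p u \o_ (g v \o_ f w))).
- apply: eq_tlift => u v; rewrite comp_tliftl; apply: eq_tlift => u' v'.
  by rewrite Defs.compA.
- by move=> v t a u u'; rewrite pL linearPl.
- by move=> u t a v v'; rewrite gL linearPl linearPr.
- by move=> u v a t t'; rewrite fL !linearPr.
Qed.

(** This is the multiplicativity of the comultiplication, read at l h. *)
Lemma translate_conv (x y z : X) (h : H) (g : H -> B y z) (f : H -> B x y) :
    linear g -> linear f ->
  translate h (conv g f) =
  \sweedler_(h1, h2 <- comul h) conv (translate h1 g) (translate h2 f).
Proof.
move=> gL fL; apply/funext => l; rewrite /translate /conv.
rewrite tlift_comulM; last exact: comp_fun_bilinear.
by rewrite exchange_tlift tlift_fct.
Qed.

End Convolution.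

(** * The span of the orbits *)

Section StandardGlobalization.
Variables (k : fieldType) (H : hopfAlgType k) (C : partial_module_category H).

Definition orbit_map (x y : obj C) (f : C x y) : H -> C x y :=
  fun l => pact l f.

(** Scalars are absorbed in the morphism, so plain sums give the linear span. *)
Definition orbit_span (x y : obj C) : {pred (H -> C x y)} :=
  fun g => `[< exists s : seq (H * C x y),
                 g = \sum_(p <- s) translate p.1 (orbit_map p.2) >].

Arguments orbit_span {x y}.

Lemma orbit_spanP (x y : obj C) (g : H -> C x y) :
  reflect (exists s : seq (H * C x y),
                 g = \sum_(p <- s) translate p.1 (orbit_map p.2))
          (g \in orbit_span).
Proof. exact: asboolP. Qed.

Lemma orbit_map_is_linear (x y : obj C) : linear (@orbit_map x y).
Proof. by move=> a f g; apply/funext => l; apply: linearPr. Qed.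

HB.instance Definition _ (x y : obj C) :=
  GRing.isLinear.Build k (C x y) (H -> C x y) *:%R (@orbit_map x y)
    (@orbit_map_is_linear x y).

Lemma orbit_span_submod (x y : obj C) : submod_closed (@orbit_span x y).
Proof.
split=> [|a f g /orbit_spanP[s ->] /orbit_spanP[t ->]].
  by apply/orbit_spanP; exists [::]; rewrite big_nil.
apply/orbit_spanP; exists ([seq (p.1, a *: p.2) | p <- s] ++ t).
rewrite big_cat big_map scaler_sumr; congr (_ + _).
apply: eq_bigr => p _; apply/funext => l /=.
by rewrite /translate /orbit_map linearZr.
Qed.

HB.instance Definition _ (x y : obj C) :=
  GRing.isSubmodClosed.Build k (H -> C x y) (@orbit_span x y)
    (@orbit_span_submod x y).

Record orbit_hom (x y : obj C) := OrbitHom {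
  ofun :> H -> C x y;
  ofunP : ofun \in @orbit_span x y
}.

HB.instance Definition _ (x y : obj C) := [isSub for @ofun x y].
HB.instance Definition _ (x y : obj C) := [Choice of orbit_hom x y by <:].
HB.instance Definition _ (x y : obj C) :=
  [SubChoice_isSubLmodule of orbit_hom x y by <:].

Section OrbitSpan.
Variables x y : obj C.

Lemma orbit_span_translate_orbit (h : H) (f : C x y) :
  translate h (orbit_map f) \in orbit_span.
Proof. by apply/orbit_spanP; exists [:: (h, f)]; rewrite big_seq1. Qed.

Lemma orbit_span_ind (P : (H -> C x y) -> Prop) :
  P 0 -> (forall g f, P g -> P f -> P (g + f)) ->
  (forall h f, P (translate h (orbit_map f))) ->
  forall g, g \in orbit_span -> P g.
Proof.
move=> P0 PD Pt g /orbit_spanP[s ->].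
by elim: s => [|p s IHs]; rewrite ?big_nil // big_cons; apply: PD.
Qed.

Lemma orbit_span_linear (g : H -> C x y) : g \in orbit_span -> linear g.
Proof.
move: g; apply: orbit_span_ind => [a u v|g f gL fL a u v|h f a u v].
- by rewrite scaler0 addr0.
- by rewrite !addrfctE gL fL scalerDr addrACA.
- by rewrite /translate mulrDl -scalerAl /orbit_map linearPl.
Qed.

Lemma orbit_span_translate (h : H) (g : H -> C x y) :
  g \in orbit_span -> translate h g \in orbit_span.
Proof.
move: g; apply: orbit_span_ind => [|g f gL fL|l f].
- exact: rpred0.
- exact: (rpredD gL fL).
- suff -> : translate h (translate l (orbit_map f)) =
              translate (h * l) (orbit_map f).
    exact: orbit_span_translate_orbit.
  by apply/funext => u; rewrite /translate mulrA.
Qed.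

Lemma orbit_span_tlift (U V : lmodType k) (b : U -> V -> H -> C x y) t :
  (forall u v, b u v \in orbit_span) -> tlift b t \in orbit_span.
Proof. by move=> bS; apply: rpred_sum => p _. Qed.

End OrbitSpan.

Lemma translate_orbit_conv (x y z : obj C) (h t : H) (g : C y z) (f : C x y) :
  conv (translate h (orbit_map g)) (translate t (orbit_map f)) =
  \sweedler_(h1, h2 <- comul h)
    translate h1 (orbit_map (g \o_ pact (antipode h2 * t) f)).
Proof.
apply/funext => l; rewrite /conv /translate /orbit_map.
by rewrite sweedler_pact_comp tlift_fct.
Qed.

Lemma orbit_span_conv (x y z : obj C) (g : H -> C y z) (f : H -> C x y) :
  g \in orbit_span -> f \in orbit_span -> conv g f \in orbit_span.
Proof.
move=> gS fS.
elim/orbit_span_ind: gS => {g} [|g g' IHg IHg'|h g].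
- by rewrite linear0l rpred0.
- by rewrite linearDl rpredD.
elim/orbit_span_ind: fS => {f} [|f f' IHf IHf'|t f].
- by rewrite linear0r rpred0.
- by rewrite linearDr rpredD.
rewrite translate_orbit_conv; apply: orbit_span_tlift => u v.
exact: orbit_span_translate_orbit.
Qed.

(** This makes the orbits an ideal of the span.  The translate by t of the orbit
    of f has value t . f at 1, and for it the equation is [pact_comp_pact];
    both sides are linear in f. *)
Lemma conv_orbit_mapl (x y z : obj C) (g : C y z) (f : H -> C x y) :
  f \in orbit_span -> conv (orbit_map g) f = orbit_map (g \o_ f 1).
Proof.
elim/orbit_span_ind => {f} [|f f' fE f'E|t f].
- by rewrite linear0r [(0 : H -> C x y) 1]/(0 : C x y) linear0r linear0.
- by rewrite linearDr /= fE f'E addrfctE linearDr linearD.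
apply/funext => l.
by rewrite /conv /translate /orbit_map mul1r pact_comp_pact.
Qed.

Lemma conv_orbit_mapr (x y z : obj C) (g : H -> C y z) (f : C x y) :
  g \in orbit_span -> conv g (orbit_map f) = orbit_map (g 1 \o_ f).
Proof.
elim/orbit_span_ind => {g} [|g g' gE g'E|t g].
- by rewrite linear0l [(0 : H -> C y z) 1]/(0 : C y z) linear0l linear0.
- by rewrite linearDl /= gE g'E addrfctE linearDl linearD.
apply/funext => l.
by rewrite /conv /translate /orbit_map mul1r pact_pact_comp.
Qed.

(** * The standard globalization *)

Lemma ofun_inj (x y : obj C) : injective (@ofun x y).
Proof. exact: val_inj. Qed.

Lemma ofun_is_linear (x y : obj C) : linear (@ofun x y).
Proof. exact: (linearP (val : orbit_hom x y -> H -> C x y)). Qed.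

HB.instance Definition _ (x y : obj C) :=
  GRing.isLinear.Build k (orbit_hom x y) (H -> C x y) *:%R (@ofun x y)
    (@ofun_is_linear x y).

Lemma ofun_linear (x y : obj C) (g : orbit_hom x y) : linear g.
Proof. exact: orbit_span_linear (ofunP g). Qed.

Definition orbit_comp (x y z : obj C) (g : orbit_hom y z) (f : orbit_hom x y) :=
  OrbitHom (orbit_span_conv (ofunP g) (ofunP f)).

Lemma orbit_comp_bilinear (x y z : obj C) :
  bilinear_for *:%R *:%R (@orbit_comp x y z).
Proof.
split=> [f a g g'|g a f f']; apply: ofun_inj => /=.
  exact: linearPl.
exact: linearPr.
Qed.

HB.instance Definition _ (x y z : obj C) :=
  bilinear_isBilinear.Build k (orbit_hom y z) (orbit_hom x y) (orbit_hom x z)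
    *:%R *:%R (@orbit_comp x y z) (@orbit_comp_bilinear x y z).

Lemma orbit_compA (x y z w : obj C) (p : orbit_hom z w) (g : orbit_hom y z)
    (f : orbit_hom x y) :
  orbit_comp p (orbit_comp g f) = orbit_comp (orbit_comp p g) f.
Proof. by apply: ofun_inj; apply: convA; apply: ofun_linear. Qed.

Definition orbit_semicategory : semicategory k (obj C) :=
  @Semicategory k (obj C) (fun x y => orbit_hom x y : lmodType k)
    (fun x y z => @orbit_comp x y z : {bilinear _ -> _ -> _})
    orbit_compA.

Definition orbit_act (x y : obj C) (h : H) (f : orbit_hom x y) :=
  OrbitHom (orbit_span_translate h (ofunP f)).

Lemma orbit_act_bilinear (x y : obj C) :
  bilinear_for *:%R *:%R (@orbit_act x y).
Proof.
split=> [f a g h|g a f f']; apply: ofun_inj => /=.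
  apply/funext => l; rewrite /translate mulrDr -scalerAr.
  exact: ofun_linear.
by [].
Qed.

HB.instance Definition _ (x y : obj C) :=
  bilinear_isBilinear.Build k H (orbit_hom x y) (orbit_hom x y)
    *:%R *:%R (@orbit_act x y) (@orbit_act_bilinear x y).

Lemma orbit_act1 (x y : obj C) (f : orbit_hom x y) : orbit_act 1 f = f.
Proof. by apply: ofun_inj; apply/funext => l; rewrite /= /translate mulr1. Qed.

Lemma orbit_actM (x y : obj C) (h l : H) (f : orbit_hom x y) :
  orbit_act (h * l) f = orbit_act h (orbit_act l f).
Proof. by apply: ofun_inj; apply/funext => u; rewrite /= /translate mulrA. Qed.

Lemma orbit_act_comp (x y z : obj C) (h : H) (g : orbit_hom y z)
    (f : orbit_hom x y) :
  orbit_act h (orbit_comp g f) =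
  \sweedler_(h1, h2 <- comul h) orbit_comp (orbit_act h1 g) (orbit_act h2 f).
Proof.
apply: ofun_inj; rewrite (linear_tlift _ _ (@ofun_is_linear x z)).
by apply: translate_conv; apply: ofun_linear.
Qed.

Definition orbit_module_semicategory : module_semicategory H (obj C) :=
  @ModuleSemicategory k H (obj C) orbit_semicategory
    (fun x y => @orbit_act x y : {bilinear _ -> _ -> _})
    orbit_act1 orbit_actM orbit_act_comp.

Lemma orbit_map_span (x y : obj C) (f : C x y) : orbit_map f \in orbit_span.
Proof.
suff <- : translate 1 (orbit_map f) = orbit_map f.
  exact: orbit_span_translate_orbit.
by apply/funext => l; rewrite /translate mulr1.
Qed.

Definition to_orbit (x y : obj C) (f : C x y) := OrbitHom (orbit_map_span f).

Lemma to_orbit_is_linear (x y : obj C) : linear (@to_orbit x y).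
Proof. by move=> a f g; apply: ofun_inj; apply: orbit_map_is_linear. Qed.

HB.instance Definition _ (x y : obj C) :=
  GRing.isLinear.Build k (C x y) (orbit_hom x y) *:%R (@to_orbit x y)
    (@to_orbit_is_linear x y).

Lemma to_orbit_comp (x y z : obj C) (g : C y z) (f : C x y) :
  to_orbit (g \o_ f) = orbit_comp (to_orbit g) (to_orbit f).
Proof. by apply: ofun_inj; apply/funext => l; apply: pact_comp. Qed.

Definition orbit_semifunctor : semifunctor C orbit_module_semicategory :=
  @Semifunctor k (obj C) C orbit_module_semicategory
    (fun x y => @to_orbit x y : {linear _ -> _}) to_orbit_comp.

Lemma orbit_faithful : faithful orbit_semifunctor.
Proof.
move=> x y f g /(congr1 (fun F => ofun F 1)).
by rewrite /= /orbit_map !pact1.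
Qed.

Lemma orbit_comp_mapl (x y z : obj C) (g : C y z) (f : orbit_hom x y) :
  orbit_comp (to_orbit g) f = to_orbit (g \o_ f 1).
Proof. by apply: ofun_inj; apply: conv_orbit_mapl; apply: ofunP. Qed.

Lemma orbit_comp_mapr (x y z : obj C) (g : orbit_hom y z) (f : C x y) :
  orbit_comp g (to_orbit f) = to_orbit (g 1 \o_ f).
Proof. by apply: ofun_inj; apply: conv_orbit_mapr; apply: ofunP. Qed.

Lemma orbit_ideal : is_ideal (image_of orbit_semifunctor).
Proof.
split.
- by move=> x y; exists 0 => //; apply: linear0.
- move=> x y a _ _ [f _ <-] [g _ <-]; exists (a *: f + g) => //.
  exact: linearP.
- move=> x y z g _ [f _ <-]; exists (ofun g 1 \o_ f) => //.
  exact/esym/orbit_comp_mapr.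
- move=> x y z _ f [g _ <-]; exists (g \o_ ofun f 1) => //.
  exact/esym/orbit_comp_mapl.
Qed.

(** Composing f with the orbit of an identity, on either side, gives the orbit
    of the value of f at 1. *)
Lemma orbit_idem :
  central_idempotent (B := orbit_module_semicategory)
    (fun x => fmap orbit_semifunctor 1_[x]).
Proof.
split=> [x|x y f]; first by rewrite -fmap_comp comp1m.
transitivity (to_orbit (ofun f 1)).
  by rewrite /= orbit_comp_mapl comp1m.
by rewrite /= orbit_comp_mapr compm1.
Qed.

Lemma orbit_gen :
  generated_by (image_of orbit_semifunctor)
    (fun x => fmap orbit_semifunctor 1_[x]).
Proof.
move=> x y; split; apply/seteqP; split=> _ [f _ <-].
- by exists (to_orbit f) => //; rewrite -[X in _ = fmap _ X]comp1m fmap_comp.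
- by exists (1_[y] \o_ ofun f 1) => //; apply/esym/orbit_comp_mapl.
- by exists (to_orbit f) => //; rewrite -[X in _ = fmap _ X]compm1 fmap_comp.
- by exists (ofun f 1 \o_ 1_[x]) => //; apply/esym/orbit_comp_mapr.
Qed.

Lemma orbit_generated (x y : obj C) (g : orbit_module_semicategory x y) :
  exists (n : nat) (a : 'I_n -> k) (h : 'I_n -> H) (f : 'I_n -> C x y),
      g = \sum_i a i *: act (h i) (fmap orbit_semifunctor (f i)).
Proof.
have /orbit_spanP[s gE] := ofunP g; pose p0 : H * C x y := (0, 0).
exists (size s), (fun=> 1).
exists (fun i => (nth p0 s i).1), (fun i => (nth p0 s i).2).
apply: ofun_inj; rewrite gE linear_sum (big_nth p0) big_mkord.
by apply: eq_bigr => i _; rewrite scale1r.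
Qed.

Lemma orbit_actl (x y : obj C) (h : H) (f : C x y) :
  fmap orbit_semifunctor (pact h f) =
  fmap orbit_semifunctor 1_[y] \o_ act h (fmap orbit_semifunctor f).
Proof.
rewrite [RHS]orbit_comp_mapl comp1m.
by rewrite /= /translate mul1r.
Qed.

Lemma orbit_actr (x y : obj C) (h : H) (f : C x y) :
  fmap orbit_semifunctor (pact h f) =
  act h (fmap orbit_semifunctor f) \o_ fmap orbit_semifunctor 1_[x].
Proof.
rewrite [RHS]orbit_comp_mapr compm1.
by rewrite /= /translate mul1r.
Qed.

Definition orbit_globalization : globalization C :=
  Globalization orbit_faithful orbit_ideal orbit_idem orbit_gen orbit_generated
    orbit_actl orbit_actr.

Lemma orbit_minimal : minimal orbit_globalization.
Proof.
move=> x y n h f hf0; apply: ofun_inj; rewrite !linear_sum.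
apply/funext => l; rewrite fct_sumE.
exact: hf0.
Qed.

End StandardGlobalization.

Arguments orbit_span {k H C x y}.

(** * Minimal globalizations as spaces of orbits *)

Section Restriction.
Variables (k : fieldType) (H : hopfAlgType k) (C : partial_module_category H).
Variable A : globalization C.

Lemma cut_exists (x y : obj C) (a : A x y) :
  exists f : C x y, fmap (gmap A) f = fmap (gmap A) 1_[y] \o_ a.
Proof.
have [genE _] := gmap_gen A x y.
have : image_of (gmap A) (fmap (gmap A) 1_[y] \o_ a) by rewrite genE; exists a.
by case=> f _ fE; exists f.
Qed.

(** The image of C is the ideal generated by the images of the identities, so
    composing with the image of 1_y projects A x y onto it; [cut a] is this
    projection of a, seen in C. *)
Definition cut (x y : obj C) (a : A x y) : C x y := sval (cid (cut_exists a)).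

Lemma gmap_cut (x y : obj C) (a : A x y) :
  fmap (gmap A) (cut a) = fmap (gmap A) 1_[y] \o_ a.
Proof. by rewrite /cut; case: cid. Qed.

Definition orbit_of (x y : obj C) (a : A x y) : H -> C x y :=
  fun l => cut (act l a).

Lemma orbit_of_is_linear (x y : obj C) : linear (@orbit_of x y).
Proof.
move=> c a b; apply/funext => l; apply: (@gmap_faithful _ _ _ A).
by rewrite linearP /= !gmap_cut !linearPr.
Qed.

HB.instance Definition _ (x y : obj C) :=
  GRing.isLinear.Build k (A x y) (H -> C x y) *:%R (@orbit_of x y)
    (@orbit_of_is_linear x y).

Lemma orbit_of_act (x y : obj C) (h : H) (a : A x y) :
  orbit_of (act h a) = translate h (orbit_of a).
Proof. by apply/funext => l; rewrite /translate /orbit_of actM. Qed.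

Lemma orbit_of_gmap (x y : obj C) (f : C x y) :
  orbit_of (fmap (gmap A) f) = orbit_map f.
Proof.
apply/funext => l; apply: (@gmap_faithful _ _ _ A).
by rewrite gmap_cut -gmap_actl.
Qed.

(** The images of the identities are central idempotents, so that cutting a
    composite amounts to cutting each factor. *)
Lemma orbit_of_comp (x y z : obj C) (b : A y z) (a : A x y) :
  orbit_of (b \o_ a) = conv (orbit_of b) (orbit_of a).
Proof.
apply/funext => l; apply: (@gmap_faithful _ _ _ A).
rewrite gmap_cut act_comp comp_tliftr /conv.
rewrite [RHS](linear_tlift (phi := fmap (gmap A) : C x z -> A x z));
  last exact: linearP.
apply: eq_tlift => u v; rewrite fmap_comp !gmap_cut.
have [idem central] := gmap_idem A.
by rewrite -Defs.compA (Defs.compA (act u b)) -central !Defs.compA idem.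
Qed.

Lemma orbit_of_span (x y : obj C) (a : A x y) : orbit_of a \in orbit_span.
Proof.
have [n [c [h [f ->]]]] := gmap_span a.
rewrite linear_sum; apply: rpred_sum => i _; rewrite linearZ; apply: rpredZ.
by rewrite /= orbit_of_act orbit_of_gmap; apply: orbit_span_translate_orbit.
Qed.

Lemma orbit_of_onto (x y : obj C) (g : H -> C x y) :
  g \in orbit_span -> exists a : A x y, orbit_of a = g.
Proof.
elim/orbit_span_ind => {g} [|_ _ [a <-] [b <-]|h f].
- by exists 0; rewrite linear0.
- by exists (a + b); rewrite linearD.
- by exists (act h (fmap (gmap A) f)); rewrite orbit_of_act orbit_of_gmap.
Qed.

(** If a is the sum of the h_i |> F(f_i), then orbit_of a at l is the sum of the
    (l h_i) . f_i, so that the condition of minimality is orbit_of a = 0. *)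
Lemma orbit_of_inj (x y : obj C) : minimal A -> injective (@orbit_of x y).
Proof.
move=> minA; apply: raddf_inj => a; rewrite /=.
have [n [c [h [f aE]]]] := gmap_span a.
have {}aE : a = \sum_i act (h i) (fmap (gmap A) (c i *: f i)).
  by rewrite aE; apply: eq_bigr => i _; rewrite linearZ linearZr.
rewrite aE => a0; apply: minA => l.
rewrite -[RHS]/((0 : H -> C x y) l) -a0 linear_sum fct_sumE.
apply: eq_bigr => i _.
by rewrite /= orbit_of_act orbit_of_gmap.
Qed.

End Restriction.

Section Uniqueness.
Variables (k : fieldType) (H : hopfAlgType k) (C : partial_module_category H).
Variables A B : globalization C.
Hypothesis minB : minimal B.

Definition transfer (x y : obj C) (a : A x y) : B x y :=
  sval (cid (orbit_of_onto B (orbit_of_span a))).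

Lemma orbit_of_transfer (x y : obj C) (a : A x y) :
  orbit_of (transfer a) = orbit_of a.
Proof. by rewrite /transfer; case: cid. Qed.

Lemma transfer_is_linear (x y : obj C) : linear (@transfer x y).
Proof.
move=> c a b; apply: (orbit_of_inj minB).
by rewrite orbit_of_transfer !linearP /= !orbit_of_transfer.
Qed.

HB.instance Definition _ (x y : obj C) :=
  GRing.isLinear.Build k (A x y) (B x y) *:%R (@transfer x y)
    (@transfer_is_linear x y).

Lemma transfer_comp (x y z : obj C) (b : A y z) (a : A x y) :
  transfer (b \o_ a) = transfer b \o_ transfer a.
Proof.
apply: (orbit_of_inj minB).
by rewrite orbit_of_comp !orbit_of_transfer orbit_of_comp.
Qed.

Lemma transfer_act (x y : obj C) (h : H) (a : A x y) :
  transfer (act h a) = act h (transfer a).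
Proof.
apply: (orbit_of_inj minB).
by rewrite orbit_of_act !orbit_of_transfer orbit_of_act.
Qed.

Lemma transfer_gmap (x y : obj C) (f : C x y) :
  transfer (fmap (gmap A) f) = fmap (gmap B) f.
Proof.
by apply: (orbit_of_inj minB); rewrite orbit_of_transfer !orbit_of_gmap.
Qed.

Definition transfer_semifunctor : semifunctor A B :=
  @Semifunctor k (obj C) A B (fun x y => @transfer x y : {linear _ -> _})
    transfer_comp.

End Uniqueness.

(** Embedded in the functions on H, both maps are the identity. *)
Lemma transferK (k : fieldType) (H : hopfAlgType k)
    (C : partial_module_category H) (A B : globalization C) (x y : obj C) :
  minimal A -> cancel (@transfer k H C A B x y) (@transfer k H C B A x y).
Proof.
by move=> minA a; apply: (orbit_of_inj minA); rewrite !orbit_of_transfer.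
Qed.

Theorem theorem4p5 (k : fieldType) (H : hopfAlgType k)
    (C : partial_module_category H) :
  (exists B : globalization C, minimal B) /\
  (forall A B : globalization C,
     minimal A -> minimal B -> inhabited (globalization_iso A B)).
Proof.
split; first by exists (orbit_globalization C); apply: orbit_minimal.
move=> A B minA minB; apply: inhabits.
exists (transfer_semifunctor A minB).
- move=> x y; exists (@transfer k H C B A x y); exact: transferK.
- exact: transfer_act.
- exact: transfer_gmap.
Qed.
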